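(* Let $n\geq 2$, let $X$ be a finite $D_n$-symmetric subset of $\mathbb{R}^2$ with at least two points, and let $\sigma$ be the standard representation of $D_n$ in $\mathbb{R}^2$. Let $E=T\mathbb{R}^2|_X$ and let $\sigma^E$ be the canonical representation of $D_n$ on the space of planar displacements $\Gamma(E)$ of $X$. If $X$ is the disjoint union of $a$ one-point sets, $b$ regular $n$-gons and $c$ semiregular $2n$-gons (the $D_n$-orbits of $X$; $a\in\{0,1\}$, $b+c>0$), then $$\sigma^E\simeq a\,\sigma\oplus(b+2c)\,\rho^{\mathrm{reg}}_{D_n}.$$
   Context: $D_n=\langle r,s\rangle$ is the dihedral group with $2n$ elements. The standard representation $\sigma:D_n\to GL(\mathbb{R}^2)$ is $\sigma(r)=\begin{pmatrix}\cos 2\pi/n&-\sin2\pi/n\\ \sin2\pi/n&\cos2\pi/n\end{pmatrix}$, $\sigma(s)=\begin{pmatrix}-1&0\\0&1\end{pmatrix}$. $X$ is $D_n$-symmetric if $\sigma(g)X=X$ for all $g\in D_n$. The orbits of $D_n$ on $X$ are: possibly $\{O\}$ ($O$ the origin), regular $n$-gons (orbits with $n$ points) and semiregular $2n$-gons (orbits with $2n$ points). $E=T\mathbb{R}^2|_X$ is the family of vector spaces $E_x=T_x\mathbb{R}^2\cong\mathbb{R}^2$, $x\in X$; $\Gamma(E)$ is the real vector space of sections, i.e. functions $\delta:X\to\mathbb{R}^2$ with $\delta(x)$ viewed in $E_x$. The canonical representation is $[\sigma^E(g)\delta](x)=\sigma(g)\,\delta(\sigma(g)^{-1}x)$. $\rho^{\mathrm{reg}}_{D_n}$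 is the (real) left regular representation: it has a basis $\{e_g\}_{g\in D_n}$ with $\rho^{\mathrm{reg}}_{D_n}(h)e_g=e_{hg}$. $\simeq$ denotes isomorphism of representations, and coefficients denote multiplicities in direct sums. *)

(* Defs.v *)
From HB Require Import structures.
From mathcomp Require Import all_boot all_order all_algebra all_fingroup.
From mathcomp Require Import all_solvable all_character finmap.
From mathcomp Require Import reals trigo.

Set Implicit Arguments.
Unset Strict Implicit.
Unset Printing Implicit Defensive.

Import GRing.Theory.
Local Open Scope ring_scope.

Section Representations.
Variables (R : fieldType) (gT : finGroupType).

(* Each [rep g] is automatically invertible, with inverse [rep g^-1], so this
   is a homomorphism from gT to GL(V); V may be of any dimension. *)
Record representation (V : lmodType R) := Representation {
  rep_fun :> gT -> V -> V;
  rep_linear : forall g, linear (rep_fun g);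
  rep1 : forall v, rep_fun 1%g v = v;
  repM : forall g h v, rep_fun (g * h)%g v = rep_fun g (rep_fun h v)
}.

Definition rep_iso (V W : lmodType R)
    (rho : representation V) (tau : representation W) : Prop :=
  exists2 phi : {linear V -> W},
    bijective phi & forall g v, phi (rho g v) = tau g (phi v).

Section DirectSum.
Variables (V W : lmodType R) (rho : representation V) (tau : representation W).

Definition rep_sum_fun (g : gT) (u : V * W) : V * W := (rho g u.1, tau g u.2).

Fact rep_sum_linear g : linear (rep_sum_fun g).
Proof. by move=> a u v; rewrite /rep_sum_fun /= !rep_linear. Qed.

Fact rep_sum1 u : rep_sum_fun 1%g u = u.
Proof. by case: u => v w; rewrite /rep_sum_fun /= !rep1. Qed.

Fact rep_sumM g h u :
  rep_sum_fun (g * h)%g u = rep_sum_fun g (rep_sum_fun h u).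
Proof. by rewrite /rep_sum_fun /= !repM. Qed.

Definition rep_sum : representation (V * W)%type :=
  Representation rep_sum_linear rep_sum1 rep_sumM.

End DirectSum.

Section Multiple.
Variables (V : lmodType R) (k : nat) (rho : representation V).

Definition rep_mul_fun (g : gT) (u : {ffun 'I_k -> V}) : {ffun 'I_k -> V} :=
  [ffun i => rho g (u i)].

Fact rep_mul_linear g : linear (rep_mul_fun g).
Proof. by move=> a u v; apply/ffunP => i; rewrite !ffunE rep_linear. Qed.

Fact rep_mul1 u : rep_mul_fun 1%g u = u.
Proof. by apply/ffunP => i; rewrite ffunE rep1. Qed.

Fact rep_mulM g h u :
  rep_mul_fun (g * h)%g u = rep_mul_fun g (rep_mul_fun h u).
Proof. by apply/ffunP => i; rewrite !ffunE repM. Qed.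

(* The direct sum of k copies of rho; the zero representation if k = 0. *)
Definition rep_mul : representation {ffun 'I_k -> V} :=
  Representation rep_mul_linear rep_mul1 rep_mulM.

End Multiple.

Section Regular.

Definition reg_basis (g : gT) : {ffun gT -> R^o} := [ffun x => (x == g)%:R].

Definition regular_fun (h : gT) (f : {ffun gT -> R^o}) : {ffun gT -> R^o} :=
  \sum_(g : gT) f g *: reg_basis (h * g)%g.

Lemma regular_funE h f x : regular_fun h f x = f (h^-1 * x)%g.
Proof.
rewrite /regular_fun sum_ffunE (bigD1 (h^-1 * x)%g) //= big1 => [|g neq_g].
  by rewrite !ffunE mulKVg eqxx addr0 [LHS]mulr1.
rewrite !ffunE; case: eqP => [def_x|_]; last by rewrite scaler0.
by rewrite def_x mulKg eqxx in neq_g.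
Qed.

Fact regular_linear h : linear (regular_fun h).
Proof. by move=> a u v; apply/ffunP => x; rewrite !(regular_funE, ffunE). Qed.

Fact regular1 f : regular_fun 1%g f = f.
Proof. by apply/ffunP => x; rewrite regular_funE invg1 mul1g. Qed.

Fact regularM g h f :
  regular_fun (g * h)%g f = regular_fun g (regular_fun h f).
Proof. by apply/ffunP => x; rewrite !regular_funE invMg mulgA. Qed.

Definition regular_rep : representation {ffun gT -> R^o} :=
  Representation regular_linear regular1 regularM.

Lemma regular_rep_basis h g : regular_rep h (reg_basis g) = reg_basis (h * g)%g.
Proof.
by apply/ffunP => x; rewrite /= regular_funE !ffunE -(inj_eq (mulgI h)) mulKVg.
Qed.

End Regular.

Section Matrix.
Variables (n : nat) (rG : mx_representation R [set: gT] n).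

Fact mx_rep_linear g : linear (fun v : 'cV[R]_n => rG g *m v).
Proof. by move=> a u v; rewrite mulmxDr scalemxAr. Qed.

Fact mx_rep1 (v : 'cV[R]_n) : rG 1%g *m v = v.
Proof. by rewrite repr_mx1 mul1mx. Qed.

Fact mx_repM g h (v : 'cV[R]_n) : rG (g * h)%g *m v = rG g *m (rG h *m v).
Proof. by rewrite repr_mxM ?inE // mulmxA. Qed.

(* The matrices act on column vectors, from the left. *)
Definition mx_rep : representation 'cV[R]_n :=
  Representation mx_rep_linear mx_rep1 mx_repM.

End Matrix.

End Representations.

Section Displacements.
Variables (R : fieldType) (gT : finGroupType) (d : nat).
Variables (sigma : mx_representation R [set: gT] d) (X : {fset 'cV[R]_d}).

Definition is_symmetric : Prop :=
  forall g : gT, [fset sigma g *m x | x in X]%fset = X.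

Definition sections : lmodType R := {ffun X -> 'cV[R]_d}.

(* The default value x of [insubd] is never used when X is symmetric: see
   [canonical_funE]. *)
Definition canonical_fun (g : gT) (delta : sections) : sections :=
  [ffun x : X => sigma g *m delta (insubd x (invmx (sigma g) *m val x))].

Hypothesis symX : is_symmetric.

Fact symmetric_inv g x : x \in X -> invmx (sigma g) *m x \in X.
Proof.
move=> Xx; rewrite -repr_mxV ?inE // -(symX g^-1%g).
exact: (@in_imfset _ _ _ (fun y => sigma g^-1%g *m y)).
Qed.

Lemma canonical_funE g delta (x y : X) :
  val y = invmx (sigma g) *m val x ->
  canonical_fun g delta x = sigma g *m delta y.
Proof. by move=> def_y; rewrite ffunE -def_y valKd. Qed.

Fact canonical_linear g : linear (canonical_fun g).
Proof.
by move=> a u v; apply/ffunP => x; rewrite !ffunE mulmxDr scalemxAr.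
Qed.

Fact canonical1 delta : canonical_fun 1%g delta = delta.
Proof.
apply/ffunP => x; rewrite (@canonical_funE _ _ x x) ?repr_mx1 ?mul1mx //.
by rewrite invmx1 mul1mx.
Qed.

Fact canonicalM g h delta :
  canonical_fun (g * h)%g delta = canonical_fun g (canonical_fun h delta).
Proof.
apply/ffunP => x.
pose y : X := [` symmetric_inv g (valP x)]%fset.
pose z : X := [` symmetric_inv h (valP y)]%fset.
rewrite (@canonical_funE g _ x y) // (@canonical_funE h _ y z) //.
rewrite (@canonical_funE _ _ x z); first by rewrite repr_mxM ?inE // mulmxA.
by rewrite /= mulmxA -!repr_mxV ?inE // -repr_mxM ?inE // invMg.
Qed.

Definition canonical_rep : representation gT sections :=
  Representation canonical_linear canonical1 canonicalM.

Definition point_orbit (x : 'cV[R]_d) : {fset 'cV[R]_d} :=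
  [fset sigma g *m x | g in [set: gT]]%fset.

Definition orbits : {fset {fset 'cV[R]_d}} :=
  [fset point_orbit x | x in X]%fset.

Definition num_orbits (k : nat) : nat :=
  #|` [fset O in orbits | (#|` O| == k)%N]%fset|.

End Displacements.

Definition dihedral_generators (n : nat) (r s : 'D_(n.*2)) : Prop :=
  [/\ <<[set r; s]>> = [set: 'D_(n.*2)],
      r ^+ n = 1, s ^+ 2 = 1 & r ^ s = r^-1]%g.

Section StandardRepresentation.
Variable R : realType.

Definition rotation (t : R) : 'M[R]_2 :=
  \matrix_(i, j) if i == j then cos t
                 else if i == ord0 then - sin t else sin t.

Definition reflection : 'M[R]_2 :=
  \matrix_(i, j) if i == j then (if i == ord0 then -1 else 1) else 0.

Definition is_standard_rep (n : nat) (r s : 'D_(n.*2))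
    (sigma : mx_representation R [set: 'D_(n.*2)] 2) : Prop :=
  sigma r = rotation (2 * pi / n%:R) /\ sigma s = reflection.

End StandardRepresentation.

(* Main.v *)
(* A covector l at a point x gives the equivariant map
     delta |-> (g |-> l (sigma g^-1 (delta (g x))))
   from sections to the regular representation.  On a free orbit, two linearly
   independent covectors at one point x separate the displacements.  On an orbit
   of n points the stabilizer of x is generated by some t whose matrix fixes x
   and is not the identity, hence is not scalar; so some covector l is
   independent of l sigma(t), and l alone separates the displacements.
   Collecting these maps over all orbits, together with the value at the origin,
   gives an injective equivariant map, which is bijective because
   #|X| = a + b n + 2 c n makes the dimensions equal. *)
From HB Require Import structures.
Require Import Defs.
From mathcomp Require Import all_boot all_order all_algebra all_fingroup.
From mathcomp Require Import all_solvable all_character finmap.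
From mathcomp Require Import zify ring lra.
From mathcomp Require Import reals trigo.

Set Implicit Arguments.
Unset Strict Implicit.
Unset Printing Implicit Defensive.

Import Order.TTheory GRing.Theory Num.Theory.
Local Open Scope ring_scope.

(** * Linear algebra: bijectivity by dimension, and covectors adapted to a 2x2 matrix *)

Lemma linear_inj_bij (K : fieldType) (U V : vectType K) (f : {linear U -> V}) :
  injective f -> dim U = dim V -> bijective f.
Proof.
move=> f_inj eq_dim; pose F : 'Hom(U, V) := linfun f.
have kerF : lker F == 0%VS.
  by apply/lker0P => u v; rewrite !lfunE; apply: f_inj.
have imF : limg F = fullv.
  apply/eqP; rewrite eqEdim subvf /= dimvf -eq_dim -dimvf.
  by rewrite -(limg_ker_dim F fullv) (eqP kerF) capv0 dimv0.
exists (F^-1%VF) => [u|v]; first by rewrite -[f u](lfunE f) lker0_lfunK.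
by rewrite -[LHS](lfunE f) limg_lfunVK // imF memvf.
Qed.

Lemma ord2P (i : 'I_2) : i = 0 \/ i = 1.
Proof. by case: i => [[|[]]] // ?; [left | right]; apply: val_inj. Qed.

(** It suffices that [l] is not a left eigenvector of [A]. If both coordinate covectors and their
    sum were eigenvectors, [A] would be scalar. *)
Lemma separating_covector (K : fieldType) (A : 'M[K]_2) :
  ~~ is_scalar_mx A ->
  exists l : 'rV[K]_2, forall v : 'cV[K]_2,
    l *m v = 0 -> l *m A *m v = 0 -> v = 0.
Proof.
move=> nscA.
have vecP (v : 'cV[K]_2) : v 0 0 = 0 -> v 1 0 = 0 -> v = 0.
  move=> v0 v1; apply/matrixP => i j; rewrite (ord1 j) mxE.
  by case: (ord2P i) => ->.
have mulE (l : 'rV[K]_2) v : (l *m v) 0 0 = l 0 0 * v 0 0 + l 0 1 * v 1 0.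
  by rewrite mxE big_ord_recl big_ord1; congr (_ + l 0 _ * v _ 0);
    apply: val_inj.
have mulAE (l : 'rV[K]_2) j : (l *m A) 0 j = l 0 0 * A 0 j + l 0 1 * A 1 j.
  by rewrite mxE big_ord_recl big_ord1; congr (_ + l 0 _ * A _ j);
    apply: val_inj.
have entry (l : 'rV[K]_2) (v : 'cV[K]_2) : l *m v = 0 -> (l *m v) 0 0 = 0.
  by move->; rewrite mxE.
have [A01|nzA01] := eqVneq (A 0 1) 0; last first.
  exists (delta_mx 0 0) => v /entry + /entry.
  rewrite !mulE !mulAE !mxE /= !mul1r !mul0r !addr0 => v0.
  rewrite v0 mulr0 add0r.
  by move/eqP; rewrite mulf_eq0 (negPf nzA01) => /eqP; apply: vecP.
have [A10|nzA10] := eqVneq (A 1 0) 0; last first.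
  exists (delta_mx 0 1) => v /entry + /entry.
  rewrite !mulE !mulAE !mxE /= !mul1r !mul0r !add0r => v1.
  rewrite v1 mulr0 addr0.
  by move/eqP; rewrite mulf_eq0 (negPf nzA10) => /eqP v0; apply: vecP.
(* [A] is diagonal here, so [l *m A] lists its diagonal entries and is proportional to the all-ones
   [l] only if they agree. *)
exists (const_mx 1) => v /entry + /entry.
rewrite !mulE !mulAE !mxE A01 A10 !mul1r addr0 add0r => v01.
have def_v1 : v 1 0 = - v 0 0 by apply/eqP; rewrite -addr_eq0 addrC v01.
rewrite def_v1 mulrN -mulrBl => /eqP; rewrite mulf_eq0 subr_eq0.
case/orP => [/eqP eqA|/eqP v0]; last by apply: vecP; rewrite ?def_v1 v0 ?oppr0.
case/is_scalar_mxP: nscA; exists (A 0 0); apply/matrixP => i j; rewrite mxE.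
by case: (ord2P i) (ord2P j) => -> [] ->; rewrite ?A01 ?A10 -?eqA.
Qed.

(** * The action on [X], its orbits, and equivariant maps out of the sections *)

Section Points.
Variables (K : fieldType) (gT : finGroupType) (d : nat).
Variables (sigma : mx_representation K [set: gT] d) (X : {fset 'cV[K]_d}).
Hypothesis symX : is_symmetric sigma X.

(** The default [x] of [insubd] is never reached when [X] is symmetric: see [val_transport]. *)
Definition transport (g : gT) (x : X) : X := insubd x (sigma g *m val x).

Lemma val_transport g x : val (transport g x) = sigma g *m val x.
Proof.
apply: insubdK; have : sigma g *m val x \in [fset sigma g *m y | y in X]%fset.
  exact: (@in_imfset _ _ _ (fun y => sigma g *m y)) (valP x).
by rewrite symX.
Qed.

Lemma transport1 x : transport 1%g x = x.
Proof. by apply: val_inj; rewrite val_transport repr_mx1 mul1mx. Qed.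

Lemma transportM g h x : transport (g * h)%g x = transport g (transport h x).
Proof. by apply: val_inj; rewrite !val_transport repr_mxM ?inE // mulmxA. Qed.

Lemma canonical_rep_transport g delta x :
  canonical_rep symX g delta (transport g x) = sigma g *m delta x.
Proof.
rewrite /= (@canonical_funE _ _ _ _ _ _ _ _ x) // val_transport.
by rewrite -repr_mxV ?inE // mulmxA -repr_mxM ?inE // mulVg repr_mx1 mul1mx.
Qed.

Lemma mem_point_orbit g x : sigma g *m x \in point_orbit sigma x.
Proof. by apply/imfsetP; exists g; rewrite ?inE. Qed.

Lemma point_orbit_id x : x \in point_orbit sigma x.
Proof. by have := mem_point_orbit 1%g x; rewrite repr_mx1 mul1mx. Qed.

Lemma eq_point_orbit x y :
  (point_orbit sigma y == point_orbit sigma x) = (y \in point_orbit sigma x).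
Proof.
apply/eqP/idP => [<-|/imfsetP[g _ ->]]; first exact: point_orbit_id.
apply/fsetP => z; apply/imfsetP/imfsetP => -[h _ ->].
  by exists (h * g)%g; rewrite ?inE // repr_mxM ?inE // mulmxA.
exists (h * g^-1)%g; rewrite ?inE //= mulmxA -repr_mxM ?inE //.
by rewrite -mulgA mulVg mulg1.
Qed.

Lemma point_orbit0 : point_orbit sigma 0 = [fset 0]%fset.
Proof.
apply/fsetP => y; rewrite inE; apply/imfsetP/eqP => [[g _ ->]|->].
  exact: mulmx0.
by exists 1%g; rewrite ?inE ?mulmx0.
Qed.

Definition stabilizer (x : 'cV[K]_d) : {set gT} := [set g | sigma g *m x == x].

Lemma card_point_orbit (x : X) :
  (#|` point_orbit sigma (val x)| * #|stabilizer (val x)|)%N = #|gT|.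
Proof.
(* Actions of type [action] are right actions, hence the inverse. *)
pose to y (g : gT) := transport g^-1%g y.
have to1 : to^~ 1%g =1 id by move=> y; rewrite /to invg1 transport1.
have toM y : act_morph to y by move=> g h; rewrite /to invMg transportM.
pose act := TotalAction to1 toM.
have -> : point_orbit sigma (val x) =
          [fset val y | y in orbit act [set: gT] x]%fset.
  apply/fsetP => z; apply/imfsetP/imfsetP => [[g _ ->]|[y /orbitP[g _ <-] ->]].
    exists (transport g x); last by rewrite val_transport.
    by apply/orbitP; exists g^-1%g; rewrite ?inE //= /to invgK.
  by exists g^-1%g; rewrite ?inE //= /to val_transport.
rewrite card_imfset; last exact: val_inj.
rewrite -cardE card_orbit.
suff -> : stabilizer (val x) = 'C_[set: gT][x | act]%g.
  by rewrite mulnC Lagrange ?subsetT // cardsT.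
apply/setP => g; rewrite setTI inE; apply/eqP/astab1P => /= [gx|].
  rewrite /to -{2}[x]transport1 -(mulVg g) transportM.
  by congr (transport _ _); apply: val_inj; rewrite val_transport.
rewrite /to => gx; rewrite -{1}gx val_transport -/(val x) mulmxA.
by rewrite -repr_mxM ?inE // mulgV repr_mx1 mul1mx.
Qed.

(** The fibre over [O] of the map [point_orbit sigma] on [X] is [O] itself. *)
Lemma card_orbits : #|` X| = (\sum_(O <- orbits sigma X) #|` O|)%N.
Proof.
rewrite card_fset_sum1 (partition_big_imfset _ (point_orbit sigma)) /=.
apply: eq_big_seq => O /imfsetP[x /= Xx ->].
rewrite big_fset_condE -card_fset_sum1; congr #|` _|.
apply/fsetP => y; rewrite !inE /= eq_point_orbit andb_idl //.
case/imfsetP => g _ ->; rewrite -(val_transport g [` Xx]%fset); exact: valP.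
Qed.

(* Frobenius reciprocity: a covector at the point p.1 of X gives an equivariant
   map to the regular representation. *)
Definition frob (p : X * 'rV[K]_d) (delta : sections X) : {ffun gT -> K^o} :=
  [ffun g => (p.2 *m sigma g^-1%g *m delta (transport g p.1)) 0 0].

Lemma frob_linear p : linear (frob p).
Proof.
by move=> a u v; apply/ffunP => g; rewrite !ffunE mulmxDr -scalemxAr !mxE.
Qed.

Lemma frob_rep p h delta :
  frob p (canonical_rep symX h delta) = regular_rep K gT h (frob p delta).
Proof.
apply/ffunP => g; rewrite regular_funE [LHS]ffunE [RHS]ffunE.
rewrite -{2}[g](mulKVg h) transportM canonical_rep_transport mulmxA.
by rewrite -(mulmxA p.2) -repr_mxM ?inE // invMg invgK.
Qed.

(** The sum has at most one term: it is the displacement at the origin, or 0 if the origin is not in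
    [X]. This form is linear without a case split. *)
Definition origin (delta : sections X) : 'cV[K]_d :=
  \sum_(x | val x == 0) delta x.

Lemma origin_linear : linear origin.
Proof.
move=> a u v; rewrite /origin scaler_sumr -big_split.
by apply: eq_bigr => x _; rewrite !ffunE.
Qed.

Lemma originE delta x : val x = 0 -> origin delta = delta x.
Proof.
move=> x0; rewrite /origin (eq_bigl (pred1 x)) ?big_pred1_eq // => y.
by rewrite /= -x0 (inj_eq val_inj).
Qed.

Lemma origin_rep h delta :
  origin (canonical_rep symX h delta) = sigma h *m origin delta.
Proof.
rewrite /origin mulmx_sumr; apply: eq_bigr => x /eqP x0.
rewrite -canonical_rep_transport; congr (_ _); apply: val_inj.
by rewrite val_transport x0 mulmx0.
Qed.

Definition coordinates (a k : nat) (p : 'I_k -> X * 'rV[K]_d)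
    (delta : sections X) :
    {ffun 'I_a -> 'cV[K]_d} * {ffun 'I_k -> {ffun gT -> K^o}} :=
  ([ffun=> origin delta], [ffun i => frob (p i) delta]).

Lemma coordinates_linear a k (p : 'I_k -> X * 'rV[K]_d) :
  linear (@coordinates a k p).
Proof.
move=> c u v; rewrite /coordinates; congr (_, _); apply/ffunP => i;
  rewrite !ffunE; [exact: origin_linear | exact: frob_linear].
Qed.

HB.instance Definition _ a k p :=
  GRing.isLinear.Build K (sections X) _ _ (@coordinates a k p)
    (@coordinates_linear a k p).

Lemma coordinates_rep a k (p : 'I_k -> X * 'rV[K]_d) g delta :
  coordinates a p (canonical_rep symX g delta) =
  rep_sum (rep_mul a (mx_rep sigma)) (rep_mul k (regular_rep K gT)) g
    (coordinates a p delta).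
Proof.
rewrite /coordinates /= /rep_sum_fun /=; congr (_, _); apply/ffunP => i.
  by rewrite !ffunE origin_rep.
by rewrite !ffunE frob_rep.
Qed.

(** Injectivity of the maps [frob p], for [p] in [L], localized at the single point [x]. *)
Definition separating (L : seq (X * 'rV[K]_d)) (x : X) : Prop :=
  forall delta, (forall p, p \in L -> frob p delta = 0) -> delta x = 0.

End Points.

(** * The planar case for a faithful group of order 2n with stabilizers of order at most 2 *)

Section Plane.
Variables (K : fieldType) (gT : finGroupType) (n : nat).
Variables (sigma : mx_representation K [set: gT] 2) (X : {fset 'cV[K]_2}).
Hypothesis symX : is_symmetric sigma X.
Hypothesis n_gt1 : (1 < n)%N.
Hypothesis card_gT : #|gT| = n.*2.
Hypothesis faithful : forall g, sigma g = 1%:M -> g = 1%g.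
Hypothesis small_stabilizer :
  forall x, x != 0 -> (#|stabilizer sigma x| <= 2)%N.

(* The number of copies of the regular representation that an orbit of m points
   contributes. *)
Definition weight (m : nat) : nat := ((m == n) + 2 * (m == n.*2))%N.

Lemma nontrivial_stabilizer_separating (x0 : X) t :
  val x0 != 0 -> t != 1%g -> sigma t *m val x0 = val x0 ->
  exists l, forall x, val x \in point_orbit sigma (val x0) ->
    separating sigma [:: (x0, l)] x.
Proof.
move=> nz_x0 nt_t fix_x0.
(* A scalar matrix fixing a nonzero vector is the identity, which faithfulness excludes for [t]. *)
have nscA : ~~ is_scalar_mx (sigma t).
  apply: contra nt_t => /is_scalar_mxP[c def_t]; apply/eqP/faithful.
  rewrite def_t; congr _%:M; apply/eqP; rewrite -subr_eq0.
  move/eqP: fix_x0; rewrite def_t mul_scalar_mx -subr_eq0 -{2}[val x0]scale1r.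
  by rewrite -scalerBl scaler_eq0 (negPf nz_x0) orbF.
have [l sep_l] := separating_covector nscA.
exists l => x /imfsetP[g _ def_x] delta sep.
have {sep} frob0 h : l *m sigma h^-1%g *m delta (transport sigma h x0) = 0.
  have /ffunP/(_ h) := sep _ (mem_head _ _); rewrite !ffunE /= => lh.
  by apply/matrixP => i j; rewrite !ord1 lh mxE.
have {}def_x : x = transport sigma g x0.
  by apply: val_inj; rewrite val_transport.
have fixV : transport sigma t^-1 x0 = x0.
  apply: val_inj; rewrite val_transport // -{1}fix_x0 mulmxA.
  by rewrite -repr_mxM ?inE // mulVg repr_mx1 mul1mx.
(* Both [g] and [g * t^-1] carry [x0] to [x]. The values of [frob] there are [l] and [l *m sigma t]
   applied to this same vector. *)
have : sigma g^-1%g *m delta x = 0.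
  apply: sep_l; first by rewrite def_x mulmxA.
  have := frob0 (g * t^-1)%g; rewrite transportM // fixV -def_x invMg invgK.
  by rewrite repr_mxM ?inE // !mulmxA.
move/(congr1 (mulmx (sigma g))).
by rewrite mulmx0 mulmxA -repr_mxM ?inE // mulgV repr_mx1 mul1mx.
Qed.

Lemma standard_covectors_separating (x0 x : X) :
  val x \in point_orbit sigma (val x0) ->
  separating sigma [:: (x0, delta_mx 0 0); (x0, delta_mx 0 1)] x.
Proof.
move=> /imfsetP[g _ def_x] delta sep.
have {}def_x : x = transport sigma g x0.
  by apply: val_inj; rewrite val_transport.
have : sigma g^-1%g *m delta x = 0.
  have rowP i : (forall h, frob sigma (x0, delta_mx 0 i) delta h = 0) ->
      (sigma g^-1%g *m delta x) i 0 = 0.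
    by move/(_ g); rewrite ffunE /= -def_x -mulmxA -rowE mxE.
  apply/matrixP => i j; rewrite ord1 [RHS]mxE; apply: rowP => h.
  by rewrite sep ?ffunE // !inE; case: (ord2P i) => ->; rewrite eqxx ?orbT.
move/(congr1 (mulmx (sigma g))).
by rewrite mulmx0 mulmxA -repr_mxM ?inE // mulgV repr_mx1 mul1mx.
Qed.

Lemma point_orbit_cases (x : X) :
  [\/ point_orbit sigma (val x) = [fset 0]%fset,
      #|` point_orbit sigma (val x)| = n /\
        exists t, [/\ t != 1%g, val x != 0 & sigma t *m val x = val x] |
      #|` point_orbit sigma (val x)| = n.*2].
Proof.
have [x0|nz_x] := eqVneq (val x) 0.
  by constructor 1; rewrite x0 point_orbit0.
have := card_point_orbit symX x; have := small_stabilizer nz_x.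
(* Without the identity, the stabilizer has at most one element; orbit-stabilizer then gives 2n or n
   points. *)
rewrite (cardsD1 1%g) inE repr_mx1 mul1mx eqxx card_gT.
have [-> _|[t tS]] := set_0Vmem (stabilizer sigma (val x) :\ 1%g).
  by rewrite cards0 muln1 => ->; constructor 3.
rewrite (cardsD1 t) tS => le2; rewrite (_ : #|_| = 0)%N; last by lia.
move=> card_orb; move: tS; rewrite !inE => /andP[nt_t /eqP fix_t].
by constructor 2; split; [lia | exists t].
Qed.

(** The bound [1 < n] keeps the three orbit sizes distinct. *)
Lemma weightE : (weight 1 = 0 /\ weight n = 1 /\ weight n.*2 = 2)%N.
Proof. by rewrite /weight; repeat split; lia. Qed.

Lemma orbit_separating (x0 : X) :
  exists2 L : seq (X * 'rV[K]_2),
    size L = weight #|` point_orbit sigma (val x0)| &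
    forall x, val x \in point_orbit sigma (val x0) -> val x != 0 ->
      separating sigma L x.
Proof.
have [w1 [wn w2n]] := weightE.
case: (point_orbit_cases x0) => [orbit0|[-> [t [nt_t nz_x0 fix_t]]]|->].
(* The orbit of the origin needs no covector: its displacement is recorded by [origin]. *)
- exists [::]; first by rewrite orbit0 cardfs1 w1.
  by move=> x; rewrite orbit0 inE => ->.
- have [l sep_l] := nontrivial_stabilizer_separating nz_x0 nt_t fix_t.
  by exists [:: (x0, l)] => // x orb_x _; apply: sep_l.
exists [:: (x0, delta_mx 0 0); (x0, delta_mx 0 1)] => // x orb_x _.
exact: standard_covectors_separating.
Qed.

(** Stated for any list of orbits to allow induction. Lists concatenate, since a longer list only
    imposes more vanishing conditions. *)
Lemma orbits_separating (s : seq {fset 'cV[K]_2}) :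
  {subset s <= orbits sigma X} ->
  exists2 L : seq (X * 'rV[K]_2),
    size L = (\sum_(O <- s) weight #|` O|)%N &
    forall x, point_orbit sigma (val x) \in s -> val x != 0 ->
      separating sigma L x.
Proof.
elim: s => [|O s IHs] sub_s; first by exists [::]; rewrite ?big_nil.
have [|L1 sz1 sep1] := IHs.
  by move=> U sU; apply: sub_s; rewrite inE sU orbT.
have /imfsetP[y /= Xy def_O] := sub_s _ (mem_head O s).
have [L2 sz2 sep2] := orbit_separating [` Xy]%fset.
exists (L2 ++ L1); first by rewrite size_cat sz1 sz2 big_cons def_O.
move=> x; rewrite inE => orb_x nz_x delta sep; case/orP: orb_x => [|sx].
  rewrite def_O eq_point_orbit => /sep2; apply=> // p Lp.
  by apply: sep; rewrite mem_cat Lp.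
by apply: (sep1 x) => // p Lp; apply: sep; rewrite mem_cat Lp orbT.
Qed.

Lemma num_orbitsE (k : nat) :
  num_orbits sigma X k = (\sum_(O <- orbits sigma X) (#|` O|%fset == k))%N.
Proof.
by rewrite /num_orbits card_fset_sum1 -big_fset_condE big_mkcond.
Qed.

Lemma card_symmetric :
  #|` X| = (num_orbits sigma X 1 + n * num_orbits sigma X n
            + n.*2 * num_orbits sigma X n.*2)%N.
Proof.
rewrite (card_orbits symX) !num_orbitsE !big_distrr -!big_split /=.
apply: eq_big_seq => O /imfsetP[x /= Xx ->].
case: (point_orbit_cases [` Xx]%fset) => [/= ->|[/= -> _]|/= ->];
  rewrite ?cardfs1; lia.
Qed.

Lemma canonical_rep_iso :
  rep_iso (canonical_rep symX)
    (rep_sum (rep_mul (num_orbits sigma X 1) (mx_rep sigma))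
       (rep_mul (num_orbits sigma X n + 2 * num_orbits sigma X n.*2)
          (regular_rep K gT))).
Proof.
have [L] := @orbits_separating (orbits sigma X) (fun _ => id).
set k := (_ + _)%N; rewrite {1}/weight big_split -big_distrr -!num_orbitsE /=.
rewrite -/k => sz_L sep_L; rewrite -sz_L.
exists (coordinates sigma (num_orbits sigma X 1) (tnth (in_tuple L)));
  last exact: coordinates_rep.
apply: linear_inj_bij => [|].
  apply: raddf_inj => delta [/ffunP origin0 /ffunP frob0].
  apply/ffunP => x; rewrite [RHS]ffunE; have [x0|nz_x] := eqVneq (val x) 0.
    (* If the origin lies in [X], its orbit is counted, so at least one copy of [origin] occurs
       among the coordinates. *)
    have orbits0_gt0 : (0 < num_orbits sigma X 1)%N.
      rewrite cardfs_gt0; apply/fset0Pn; exists [fset 0]%fset.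
      rewrite !inE cardfs1 eqxx andbT -(point_orbit0 sigma) -x0.
      by rewrite in_imfset //= valP.
    have := origin0 (Ordinal orbits0_gt0).
    by rewrite !ffunE (originE _ x0).
  apply: sep_L => // [|p /(tnthP (in_tuple L))[i ->]].
    by rewrite in_imfset //= valP.
  by have := frob0 i; rewrite !ffunE.
(* The dimensions are computed: 2|X| on the left, 2a + (b + 2c)(2n) on the right. *)
change (#|{: X}| * dim 'cV[K]_2 =
  #|'I_(num_orbits sigma X 1)| * dim 'cV[K]_2 + #|'I_(size L)| * (#|gT| * 1))%N.
rewrite !card_ord dim_matrix -cardfE card_symmetric sz_L card_gT /k; lia.
Qed.
End Plane.

(** * Rotations, reflections and the standard representation of the dihedral group *)

Lemma det_mx2 (K : comNzRingType) (A : 'M[K]_2) :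
  \det A = A 0 0 * A 1 1 - A 0 1 * A 1 0.
Proof.
rewrite (expand_det_row _ 0) big_ord_recl big_ord1 /cofactor !det_mx11 !mxE /=.
have lift10 : lift 1 0 = 0 :> 'I_2 by apply: val_inj.
have lift01 : lift ord0 ord0 = 1 :> 'I_2 by apply: val_inj.
rewrite lift01 (lift10 : lift 1 (0 : 'I_1) = 0) /bump /=; ring.
Qed.

Section Dihedral.
Variable R : realType.

Lemma rotationD (t u : R) : rotation t *m rotation u = rotation (t + u).
Proof.
apply/matrixP => i j; rewrite !mxE big_ord_recl big_ord1 !mxE cosD sinD.
rewrite (_ : lift ord0 ord0 = 1) //; last exact: val_inj.
case: (ord2P i) (ord2P j) => -> [] -> /=; ring.
Qed.

Lemma rotationX (t : R) i : rotation t ^+ i = rotation (t *+ i).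
Proof.
elim: i => [|i IHi]; last by rewrite exprS IHi -mulmxE rotationD mulrS.
apply/matrixP => i j; rewrite expr0 mulr0n !mxE cos0 sin0 oppr0.
by case: (i == j); rewrite ?if_same.
Qed.

Lemma det_rotation (t : R) : \det (rotation t) = 1.
Proof. by rewrite det_mx2 !mxE /= -(cos2Dsin2 t); ring. Qed.

Lemma det_reflection : \det (reflection R) = -1.
Proof. by rewrite det_mx2 !mxE /=; ring. Qed.

Lemma rotation_fix (t : R) (v : 'cV_2) :
  v != 0 -> rotation t *m v = v -> cos t = 1.
Proof.
move=> nz_v fix_v; have tr := cos2Dsin2 t.
have rowE i : rotation t i 0 * v 0 0 + rotation t i 1 * v 1 0 = v i 0.
  rewrite -[in RHS]fix_v [RHS]mxE big_ord_recl big_ord1.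
  by congr (_ + rotation t i _ * v _ 0); apply: val_inj.
have /eqP := rowE 0; have /eqP := rowE 1; rewrite !mxE /= => /eqP e1 /eqP e0.
apply/eqP; apply: contraNT nz_v => neq1; apply/eqP/matrixP => i j.
(* This is the determinant of [rotation t - 1]; if it is nonzero, only 0 is fixed. *)
have {}neq1 : 2 * (1 - cos t) != 0.
  by rewrite mulf_neq0 ?pnatr_eq0 // subr_eq0 eq_sym.
rewrite ord1 [RHS]mxE; apply: (mulfI neq1); rewrite mulr0.
case: (ord2P i) => ->; nra.
Qed.

Lemma cos_eq1 (n i : nat) :
  (i < n)%N -> cos (2 * pi / n%:R *+ i) = 1 :> R -> i = 0%N.
Proof.
(* Half the angle, [x], lies strictly between 0 and [pi], while cos(2x) = 1 would force sin(x) =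
   0. *)
case: i => // i lt_in; set x : R := pi / n%:R *+ i.+1.
have -> : 2 * pi / n%:R *+ i.+1 = x *+ 2 by rewrite /x; ring.
have /sin_gt0_pi : 0 < x < pi.
  have n_gt0 : 0 < n%:R :> R by rewrite ltr0n; lia.
  rewrite /x -mulr_natr mulrAC divr_gt0 ?mulr_gt0 ?pi_gt0 ?(ltr0n _ i.+1) //=.
  by rewrite ltr_pdivrMr // ltr_pM2l ?pi_gt0 // ltr_nat.
rewrite cos_mulr2n cos2sin2 => sin_gt0 sin0; exfalso; nra.
Qed.

Variables (n : nat) (r s : 'D_(n.*2)).
Variable sigma : mx_representation R [set: 'D_(n.*2)] 2.
Hypothesis n_gt1 : (1 < n)%N.
Hypothesis gen : dihedral_generators r s.
Hypothesis std : is_standard_rep r s sigma.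

(** The relation [r ^ s = r^-1] makes [s] normalize [<[r]>], so the generated group is the
    product. *)
Lemma dihedral_mulg_cycles : (<[r]> * <[s]> = [set: 'D_(n.*2)])%g.
Proof.
have [<- _ _ rs] := gen; rewrite -norm_joinEr ?joing_idl ?joing_idr //.
by rewrite cycle_subG; apply/normP; rewrite -cycleJ rs cycleV.
Qed.

Lemma repr_rotation i : sigma (r ^+ i)%g = rotation (2 * pi / n%:R *+ i).
Proof. by rewrite -rotationX -(proj1 std) repr_mxX ?inE. Qed.

Lemma cycle_rotation_fix g (v : 'cV[R]_2) :
  g \in <[r]>%g -> v != 0 -> sigma g *m v = v -> g = 1%g.
Proof.
case/cycleP => i -> nz_v; have [_ rn _ _] := gen.
(* The exponent is reduced mod [n], into the range of [cos_eq1]. *)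
rewrite -(expg_mod i rn) repr_rotation => /(rotation_fix nz_v) /cos_eq1.
by rewrite ltn_mod => -> //; lia.
Qed.

(** The determinant is -1 off the rotations, so the kernel lies in [<[r]>], where fixing one nonzero
    vector already forces the identity. *)
Lemma standard_rep_faithful g : sigma g = 1%:M -> g = 1%g.
Proof.
have [_ _ s2 _] := gen.
have : (g \in <[r]> * <[s]>)%g by rewrite dihedral_mulg_cycles inE.
case/mulsgP => [x y xr /cycleP[j ->] ->] sg1.
suff even_j : ~~ odd j.
  have sj1 : (s ^+ j = 1)%g by rewrite -(expg_mod j s2) modn2 (negPf even_j).
  have nz1 : (const_mx 1 : 'cV[R]_2) != 0.
    by apply/eqP => /matrixP/(_ 0 0)/eqP; rewrite !mxE oner_eq0.
  move: sg1; rewrite sj1 mulg1 => sx1.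
  by rewrite (cycle_rotation_fix xr nz1) // sx1 mul1mx.
have /cycleP[i def_x] := xr; apply/negP => odd_j.
have := congr1 determinant sg1; rewrite det1 -(expg_mod j s2) modn2 odd_j expg1.
rewrite def_x repr_mxM ?inE // repr_rotation (proj2 std) det_mulmx.
rewrite det_rotation det_reflection mul1r => /eqP.
by rewrite eq_sym -addr_eq0 -mulr2n pnatr_eq0.
Qed.

(** The stabilizer meets [<[r]>] trivially, and [<[r]>] has index at most 2. *)
Lemma card_standard_stabilizer (v : 'cV[R]_2) :
  v != 0 -> (#|stabilizer sigma v| <= 2)%N.
Proof.
move=> nz_v; have [_ _ s2 _] := gen.
have gS : group_set (stabilizer sigma v).
  apply/group_setP; split=> [|g h]; rewrite !inE ?repr_mx1 ?mul1mx //.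
  by move=> /eqP gv /eqP hv; rewrite repr_mxM ?inE // -mulmxA hv gv.
have TI : (Group gS :&: <[r]> = 1)%g.
  apply/trivgP/subsetP => g /setIP[]; rewrite inE => /eqP gv gr.
  by rewrite inE (cycle_rotation_fix gr nz_v gv).
have le_s : (#|<[s]>%g| <= 2)%N.
  by apply: dvdn_leq => //; rewrite order_dvdn s2.
have le_G : (#|[set: 'D_(n.*2)]| <= 2 * #|<[r]>%g|)%N.
  rewrite -dihedral_mulg_cycles mulnC.
  apply: leq_trans (leq_mul (leqnn _) le_s).
  by rewrite mul_cardG leq_pmulr.
rewrite -(leq_pmul2r (cardG_gt0 <[r]>)) -(TI_cardMg TI).
exact: leq_trans (subset_leq_card (subsetT _)) le_G.
Qed.

End Dihedral.

Theorem theorem4p4 (R : realType) (n : nat) (r s : 'D_(n.*2))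
    (sigma : mx_representation R [set: 'D_(n.*2)] 2)
    (X : {fset 'cV[R]_2}) (symX : is_symmetric sigma X) (a b c : nat) :
  (2 <= n)%N ->
  dihedral_generators r s ->
  is_standard_rep r s sigma ->
  (2 <= #|` X|)%N ->
  (a <= 1)%N -> (0 < b + c)%N ->
  num_orbits sigma X 1 = a ->
  num_orbits sigma X n = b ->
  num_orbits sigma X (n.*2) = c ->
  rep_iso (canonical_rep symX)
    (rep_sum (rep_mul a (mx_rep sigma))
             (rep_mul (b + 2 * c) (regular_rep R 'D_(n.*2)))).
Proof.
move=> n_gt1 gen std _ _ _ <- <- <-.
apply: canonical_rep_iso => // [|g|v].
- by rewrite -cardsT card_dihedral.
- exact: (standard_rep_faithful n_gt1 gen std).
exact: (card_standard_stabilizer n_gt1 gen std).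
Qed.
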